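(* Let $G$ be a countable discrete amenable group and $X$ a countable discrete set. Then any action $\alpha: G \curvearrowright X$ is sofic.
   Context: For a nonempty finite set $A$, $\mathrm{Sym}(A)$ is the group of permutations of $A$, with the normalized Hamming distance $d(\sigma,\tau) = |\{a \in A : \sigma(a) \neq \tau(a)\}|/|A|$. Let $\alpha: G \curvearrowright X$ be an action of a countable discrete group on a countable discrete set, $A$ a finite set, $\varphi: G \to \mathrm{Sym}(A)$ a map (not necessarily a homomorphism). $\varphi$ is unital if $\varphi(1_G) = 1$. For finite $F \subseteq G$ and $\epsilon > 0$, $\varphi$ is $(F,\epsilon)$-multiplicative if $d(\varphi(gh), \varphi(g)\varphi(h)) < \epsilon$ for all $g,h \in F$. For finite $F \subseteq G$, finite $E \subseteq X$ and $\epsilon > 0$, $\varphi$ is an $(F,E,\epsilon)$-orbit approximation of $\alpha$ if there exist a finite set $B$ and a subset $S \subseteq A$ with $|S| > (1-\epsilon)|A|$ and, for each $s \in S$, an injective map $\pi_s: E \hookrightarrow B$, such that $\pi_{\varphi(g)s}(x) = \pi_s(\alpha(g^{-1})x)$ for all $s \in S$, $g \in F$, $x \in E$ whenever $\varphi(g)s \in S$ and $\alpha(g^{-1})x \in E$. The action $\alpha$ is sofic if for all finite $F \subseteq G$, finite $E \subseteq X$ and $\epsilon > 0$ there exist a finite set $A$ and a map $\varphi: G \to \mathrm{Sym}(A)$ which is unital, $(F,\epsilon)$-multiplicative, and an $(F,E,\epsilon)$-orbit approximation of $\alpha$. *)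

(* Defs.v *)
From HB Require Import structures.
From mathcomp Require Import all_boot all_order all_fingroup all_algebra finmap.
From mathcomp Require Import boolp classical_sets functions cardinality reals.

Set Implicit Arguments.
Unset Strict Implicit.
Unset Printing Implicit Defensive.

Import Order.TTheory GRing.Theory Num.Theory.

Local Open Scope classical_set_scope.
Local Open Scope ring_scope.

Definition is_left_action (G : groupType) (X : Type) (act : G -> X -> X) : Prop :=
  (forall x : X, act 1%g x = x) /\
  (forall (g h : G) (x : X), act (g * h)%g x = act g (act h x)).

(* Amenability of a discrete group, in von Neumann's form: a finitely additive,
   left-invariant probability measure on all subsets of G. *)
Definition amenable (R : realType) (G : groupType) : Prop :=
  exists mu : set G -> R,
    [/\ forall A : set G, 0 <= mu A,
        mu [set: G] = 1,
        forall A B : set G, A `&` B = set0 -> mu (A `|` B) = mu A + mu B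
      & forall (g : G) (A : set G), mu [set (g * a)%g | a in A] = mu A].

Section SoficAction.
Variable R : realType.

Definition hamming (A : finType) (s t : {perm A}) : R :=
  #|[pred a | s a != t a]|%:R / #|A|%:R.

Variables (G : groupType) (A : finType) (phi : G -> {perm A}).

Definition unital : Prop := phi 1%g = 1%g.

(* Products in {perm A} are applied left to right, (s * t) a = t (s a), so the
   composition phi(g) o phi(h) is phi h * phi g. *)
Definition multiplicative_upto (F : {fset G}) (eps : R) : Prop :=
  forall g h : G, g \in F -> h \in F ->
    hamming (phi (g * h)%g) (phi h * phi g)%g < eps.

(* The values of pi at s \notin S are irrelevant. Taking pi total in s loses no
   generality: B may be enlarged by one point. *)
Definition orbit_approximation (X : choiceType) (act : G -> X -> X)
    (F : {fset G}) (E : {fset X}) (eps : R) : Prop :=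
  exists (B : finType) (S : {set A}) (pi : A -> E -> B),
    [/\ (1 - eps) * #|A|%:R < #|S|%:R,
        forall s : A, s \in S -> injective (pi s)
      & forall (s : A) (g : G) (x y : E),
          s \in S -> g \in F -> phi g s \in S ->
          val y = act g^-1%g (val x) ->
          pi (phi g s) x = pi s y].

End SoficAction.

Definition sofic_action (R : realType) (G : groupType) (X : choiceType)
    (act : G -> X -> X) : Prop :=
  forall (F : {fset G}) (E : {fset X}) (eps : R), 0 < eps ->
    exists (A : finType) (phi : G -> {perm A}),
      [/\ (0 < #|A|)%N,
          unital phi,
          multiplicative_upto phi F eps
        & orbit_approximation phi act F E eps].

(* Main.v *)
(* A Folner set [K] is itself the sofic model: [phi g] is a permutation of [K]
   extending the partial injection [k |-> g k], and [pi_s x = s^-1 x].  Folner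
   sets come from the invariant mean by contraposition: without them, iterating
   the expansion of [F] gives a finite [s] with [2 |K| <= |s K|] for all finite
   [K]; the infinite marriage theorem then provides two injections [G -> G] with
   disjoint images, both piecewise left translations by elements of [s], so the
   mean of each image is 1. *)
Require Import Defs.
From mathcomp Require Import all_boot all_fingroup.
From mathcomp Require Import classical_sets cardinality reals.
From mathcomp Require Import all_order all_algebra finmap boolp.
From mathcomp Require Import ring lra.

Set Implicit Arguments.
Unset Strict Implicit.
Unset Printing Implicit Defensive.

Import Order.TTheory GRing.Theory Num.Theory.

(** * Infinite marriage theorem for families of finite sets *)

Section Hall.
Local Open Scope fset_scope.
Variables (I T : choiceType).
Implicit Types (S : I -> {fset T}) (J : {fset I}).

Definition neighbours S J : {fset T} := \bigcup_(i <- J) S i.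

Definition hall_condition S := forall J, #|` J| <= #|` neighbours S J|.

Lemma neighboursP S J x :
  reflect (exists2 i, i \in J & x \in S i) (x \in neighbours S J).
Proof.
by apply: (iffP (bigfcupP _ _ _ _)) => -[i]; [rewrite andbT|]; exists i; rewrite ?andbT.
Qed.

Lemma neighboursS S1 S2 J : (forall i, i \in J -> S1 i `<=` S2 i) ->
  neighbours S1 J `<=` neighbours S2 J.
Proof.
move=> sub; apply/fsubsetP => x /neighboursP[i iJ xi].
by apply/neighboursP; exists i => //; exact: (fsubsetP (sub i iJ)).
Qed.

(** Lower bound of a chain for Zorn's lemma. The condition involves finitely many sets at a time,
    and on a finite [J] the intersection of the chain is already attained by one member. *)
Lemma hall_condition_chain S (C : set (I -> {fset T})) :
  hall_condition S ->
  (forall S', C S' -> hall_condition S' /\ forall i, S' i `<=` S i) ->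
  total_on C (fun S1 S2 => forall i, S2 i `<=` S1 i) ->
  hall_condition (fun i => [fset x in S i | `[< forall S', C S' -> x \in S' i >]]).
Proof.
move=> hS hC totC J; have [[S0 CS0]|noC] := pselect (exists S', C S'); last first.
  apply: leq_trans (hS J) _; apply/fsubset_leq_card/neighboursS => i _.
  apply/fsubsetP => x xS; rewrite !inE /= xS; apply/asboolP => S' CS'.
  by case: noC; exists S'.
(* A member of least total size over [J] is the smallest on all of [J]: a member below it that lost
   an element at some [i] in [J] would weigh less. *)
pose weight S' := \sum_(i <- J) #|` S' i|.
have exw : exists n, `[< exists2 S', C S' & weight S' = n >].
  by exists (weight S0); apply/asboolP; exists S0.
case: (ex_minnP exw) => _ /asboolP[S1 CS1 <-] minS1.
have leS1 S' i : C S' -> i \in J -> S1 i `<=` S' i.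
  move=> CS' iJ; have [le|le] := totC _ _ CS1 CS'; last exact: le.
  have: weight S1 <= weight S' by apply: minS1; apply/asboolP; exists S'.
  rewrite /weight [X in X <= _](big_fsetD1 i iJ) [X in _ <= X](big_fsetD1 i iJ) /=.
  move=> ltw.
  have leW : \sum_(j <- J `\ i) #|` S' j| <= \sum_(j <- J `\ i) #|` S1 j|.
    by apply: leq_sum => j _; exact: fsubset_leq_card.
  have lei : #|` S1 i| <= #|` S' i|.
    by rewrite -(leq_add2r (\sum_(j <- J `\ i) #|` S' j|)) (leq_trans _ ltw) ?leq_add2l.
  have /eqP <- : S' i == S1 i by rewrite eqEfcard le.
  exact: fsubset_refl.
have [hS1 S1S] := hC _ CS1.
apply: leq_trans (hS1 J) _; apply/fsubset_leq_card/neighboursS => i iJ.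
apply/fsubsetP => x xS; rewrite !inE /= (fsubsetP (S1S i)) //=.
by apply/asboolP => S' CS'; apply: (fsubsetP (leS1 _ _ _ _)) xS.
Qed.

Lemma minimal_hall_condition S : hall_condition S ->
  exists M, [/\ hall_condition M, forall i, M i `<=` S i
    & forall S', hall_condition S' -> (forall i, S' i `<=` M i) -> S' = M].
Proof.
move=> hS.
pose Q := {S' : I -> {fset T} | hall_condition S' /\ forall i, S' i `<=` S i}.
(* Inclusion is reversed, so that the maximal element given by Zorn's lemma is a minimal family. *)
pose le (s t : Q) := `[< forall i, sval t i `<=` sval s i >].
have qS : hall_condition S /\ forall i, S i `<=` S i by split.
have le_refl t : le t t by apply/asboolP.
have le_trans r s t : le r s -> le s t -> le r t.
  move=> /asboolP rs /asboolP st; apply/asboolP => i.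
  exact: fsubset_trans (st i) (rs i).
have [A totA|[M [hM MS]] maxM] := @ZL_preorder Q (exist _ S qS) le le_refl le_trans.
  pose C : set (I -> {fset T}) := [set S' | exists2 q, A q & sval q = S']%classic.
  have qC S' : C S' -> hall_condition S' /\ forall i, S' i `<=` S i.
    by move=> [[? ?] _ <-].
  have totC : total_on C (fun S1 S2 => forall i, S2 i `<=` S1 i).
    move=> _ _ [q Aq <-] [r Ar <-].
    by have [/asboolP|/asboolP] := totA _ _ Aq Ar; [left|right].
  have hM := hall_condition_chain hS qC totC.
  set M := (fun i => _) in hM.
  have MS i : M i `<=` S i by apply/fsubsetP => x; rewrite !inE => /andP[].
  exists (exist _ M (conj hM MS)) => q Aq; apply/asboolP => i /=.
  apply/fsubsetP => x; rewrite !inE => /andP[_ /asboolP]; apply.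
  by exists q.
exists M; split=> // S' hS' S'M; apply/funext => i.
have S'S j : S' j `<=` S j := fsubset_trans (S'M j) (MS j).
have /asboolP/(_ i)/= MS' := maxM (exist _ S' (conj hS' S'S)) (asboolT S'M).
by apply/eqP; rewrite eqEfsubset S'M.
Qed.

(* Rado's argument: if both [x] and [y] in [M i] could not be removed, two
   witnesses [J1], [J2] would contradict the condition for [i |` J1 `|` J2]
   and [J1 `&` J2] by submodularity of the cardinal. *)
Lemma minimal_hall_condition_eq M : hall_condition M ->
  (forall S, hall_condition S -> (forall i, S i `<=` M i) -> S = M) ->
  forall i x y, x \in M i -> y \in M i -> x = y.
Proof.
move=> hM minM i x y xi yi; apply: contrapT => xy.
pose remove z j := if j == i then M j `\ z else M j.
have witness z : z \in M i ->
    exists2 J, i \notin J & #|` neighbours M J `|` (M i `\ z)| <= #|` J|.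
  move=> zi; have /existsNP[J /negP] : ~ hall_condition (remove z).
    move=> /minM rM; have: remove z i = M i.
      by rewrite rM // => j; rewrite /remove; case: eqP => // _; exact: fsubsetDl.
    by rewrite /remove eqxx => /fsetP/(_ z); rewrite !inE eqxx zi.
  rewrite -ltnNge => ltJ.
  (* A set of indices violating the condition must contain [i], since [remove z] agrees with [M]
     elsewhere. *)
  have iJ : i \in J.
    apply: contraLR ltJ => iJ; rewrite -leqNgt; apply: leq_trans (hM J) _.
    apply/fsubset_leq_card/neighboursS => j jJ; rewrite /remove.
    by case: eqP iJ => // <-; rewrite jJ.
  exists (J `\ i); first by rewrite !inE eqxx.
  rewrite -ltnS; move: ltJ; rewrite (cardfsD1 i J) iJ; apply: leq_trans.
  rewrite ltnS; apply/fsubset_leq_card/fsubsetP => w.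
  rewrite inE => /orP[/neighboursP[j]|wM]; last first.
    by apply/neighboursP; exists i => //; rewrite /remove eqxx.
  by rewrite 2!inE => /andP[/negPf ji jJ] wj; apply/neighboursP; exists j; rewrite // /remove ji.
have [J1 iJ1 le1] := witness x xi.
have [J2 iJ2 le2] := witness y yi.
have := leq_add le1 le2; rewrite -cardfsUI -[X in _ <= X]cardfsUI leqNgt => /negP; apply.
rewrite -addSn; apply: leq_add; last first.
  apply: leq_trans (hM _) _; apply/fsubset_leq_card/fsubsetP => w.
  move=> /neighboursP[j]; rewrite !inE => /andP[j1 j2] wj.
  by apply/andP; split; apply/orP; left; apply/neighboursP; exists j.
(* The index [i] lies in neither [J1] nor [J2], which supplies the extra unit. *)
have <- : #|` i |` (J1 `|` J2)| = #|` J1 `|` J2|.+1.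
  by rewrite cardfsU1 inE negb_or iJ1 iJ2.
apply: leq_trans (hM _) _; apply/fsubset_leq_card/fsubsetP => w.
move=> /neighboursP[j]; rewrite !inE.
have nbh J : j \in J -> w \in M j -> w \in neighbours M J.
  by move=> jJ wj; apply/neighboursP; exists j.
case/or3P => [/eqP->|j1|j2] wj; last 2 first.
- by rewrite (nbh J1).
- by rewrite (nbh J2) ?orbT.
(* As [x] and [y] differ, every element of [M i] survives the removal of one of them. *)
rewrite wj !andbT; have [->|_] := eqVneq w x; last by rewrite !orbT.
by case: eqP => // _; rewrite !orbT.
Qed.

(** A minimal family consists of singletons: the condition at one index forbids empty sets, and at
    two indices it forbids equal singletons. *)
Lemma hall_injection S : hall_condition S ->
  exists2 f : I -> T, injective f & forall i, f i \in S i.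
Proof.
move=> /minimal_hall_condition[M [hM MS minM]].
have M1 := minimal_hall_condition_eq hM minM.
have neM i : exists x, x \in M i.
  have : 0 < #|` neighbours M [fset i]| by apply: leq_trans (hM _); rewrite cardfs1.
  rewrite cardfs_gt0 => /fset0Pn[x].
  by move=> /neighboursP[j]; rewrite inE => /eqP->; exists x.
have [f fM] := choice neM; exists f => [i j fij|i]; last exact: (fsubsetP (MS i)).
have /fsubset_leq_card : neighbours M [fset i; j] `<=` [fset f i].
  apply/fsubsetP => x /neighboursP[k]; rewrite !inE.
  by case/orP => /eqP-> xM; apply/eqP; [|rewrite fij]; exact: M1 xM (fM _).
move=> /(leq_trans (hM _)); rewrite cardfs1 cardfs2.
by case: eqP.
Qed.

End Hall.

(** * Folner sets from an invariant mean *)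

Section Folner.
Variables (R : realType) (G : groupType).
Local Open Scope fset_scope.

Definition fset_mul (A B : {fset G}) : {fset G} := [fset (a * b)%g | a in A, b in B].

Lemma fset_mulP (A B : {fset G}) x :
  reflect (exists2 a, a \in A & exists2 b, b \in B & x = (a * b)%g)
          (x \in fset_mul A B).
Proof. exact: imfset2P. Qed.

Lemma mem_fset_mul (A B : {fset G}) a b :
  a \in A -> b \in B -> (a * b)%g \in fset_mul A B.
Proof. by move=> aA bB; apply/fset_mulP; exists a => //; exists b. Qed.

Section Paradoxical.
Local Open Scope classical_set_scope.
Local Open Scope ring_scope.
Variable mu : set G -> R.
Hypothesis mu_additive :
  forall A B : set G, A `&` B = set0 -> mu (A `|` B) = mu A + mu B.
Hypothesis mu_invariant :
  forall (g : G) (A : set G), mu [set (g * a)%g | a in A] = mu A.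

(** Sort the points of [D] by the translating element [f x * x^-1], which takes finitely many
    values. Each piece is moved by one left translation, and injectivity keeps the images disjoint,
    so invariance and additivity conclude by induction on [s]. *)
Lemma mu_piecewise_translation (s : seq G) (f : G -> G) (D : set G) :
  injective f -> (forall x, D x -> (f x * x^-1)%g \in s) -> mu (f @` D) = mu D.
Proof.
have mu0 : mu set0 = 0.
  have := @mu_additive set0 set0; rewrite setI0 setU0 => /(_ erefl) /eqP.
  by rewrite -subr_eq0 opprD addNKr oppr_eq0 => /eqP.
move=> inj_f; elim: s D => [|g s IH] D Ds.
  suff -> : D = set0 by rewrite image_set0.
  by apply/seteqP; split=> x // /Ds.
pose D1 := [set x | D x /\ (f x * x^-1)%g = g].
pose D2 := [set x | D x /\ (f x * x^-1)%g <> g].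
have DE : D = D1 `|` D2.
  apply/seteqP; split=> x; last by case=> -[].
  by move=> Dx; have [|] := pselect ((f x * x^-1)%g = g); [left|right].
have D12 : D1 `&` D2 = set0 by rewrite -subset0 => x [[_ eg] [_ /(_ eg)]].
have fD12 : f @` D1 `&` f @` D2 = set0.
  rewrite -subset0 => _ [[x D1x <-] [y D2y /inj_f yx]].
  by have : set0 x by rewrite -D12; split; [exact: D1x|rewrite -yx].
have fD1 : f @` D1 = [set (g * a)%g | a in D1].
  apply/seteqP; split=> _ [x D1x <-]; exists x => //; case: D1x => _ <-;
  by rewrite mulgVK.
rewrite DE image_setU !mu_additive // fD1 mu_invariant; congr (_ + _).
apply: IH => x [Dx /eqP/negPf ne]; have := Ds x Dx.
by rewrite inE ne.
Qed.
End Paradoxical.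

Lemma amenable_not_doubling (s : {fset G}) : amenable R G ->
  ~ (forall K : {fset G}, (2 * #|` K| <= #|` fset_mul s K|)%N).
Proof.
move=> [mu [mu_ge0 mu1 muD mu_inv]] doubling.
(* Each group element appears in two copies, both choosing in its translate by [s]; an injective
   choice is a pair of injections of [G] with disjoint images. *)
pose S (gb : G * bool) := [fset (a * gb.1)%g | a in s].
have hS : hall_condition S.
  move=> J; pose K := [fset gb.1 | gb in J].
  pose K_ (b : bool) : {fset G * bool} := [fset (k, b) | k in K].
  (* At most two indices lie over each element of [K], which the doubling of [K] compensates. *)
  have JK : J `<=` K_ true `|` K_ false.
    apply/fsubsetP => -[k b] kJ.
    have kb : (k, b) \in K_ b.
      by apply: in_imfset => /=; apply/imfsetP; exists (k, b).
    by case: b kb {kJ} => kb; rewrite inE kb ?orbT.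
  have cardK_ b : #|` K_ b| = #|` K| by apply: card_imfset => x y [].
  apply: leq_trans (fsubset_leq_card JK) _.
  rewrite (leq_trans (n := #|` K_ true| + #|` K_ false|)) //.
    by rewrite -cardfsUI leq_addr.
  rewrite !cardK_ addnn -mul2n.
  apply: leq_trans (doubling K) _; apply/fsubset_leq_card/fsubsetP => x.
  move=> /fset_mulP[a sa [_ /imfsetP[gb /= gbJ ->] ->]].
  apply/neighboursP; by exists gb => //; apply/imfsetP; exists a.
have [f inj_f fS] := hall_injection hS.
have mu_f b : mu [set f (x, b) | x in [set: G]]%classic = 1%R.
  rewrite -mu1; apply: (mu_piecewise_translation muD mu_inv (s := s)).
    by move=> x y /inj_f[].
  by move=> x _; have /imfsetP[a /= sa ->] := fS (x, b); rewrite mulgK.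
have ge1 (A : set G) : (mu A <= 1)%R.
  by rewrite -mu1 -(setvU A) muD ?setICl // lerDr.
have := ge1 ([set f (x, true) | x in [set: G]] `|` [set f (x, false) | x in [set: G]])%classic.
rewrite muD ?mu_f; first lra.
by rewrite -subset0 => _ [[x _ <-] [y _ /inj_f]].
Qed.

Lemma folner (F : {fset G}) (eps : R) : amenable R G -> (0 < eps)%R ->
  exists2 K : {fset G}, K != fset0 &
    forall g, g \in F -> (#|` [fset k in K | (g * k)%g \notin K]|%:R <= eps * #|` K|%:R)%R.
Proof.
move=> amenG eps0; apply: contrapT => noK.
(* With the unit adjoined, [F1 K] contains both [K] and the elements that [F] moves out of [K]. *)
pose F1 := 1%g |` F.
have grow (K : {fset G}) : ((1 + eps) * #|` K|%:R <= #|` fset_mul F1 K|%:R :> R)%R.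
  have [->|K0] := eqVneq K fset0; first by rewrite cardfs0 mulr0.
  have [g gF] : exists2 g, g \in F &
      (eps * #|` K|%:R < #|` [fset k in K | (g * k)%g \notin K]|%:R)%R.
    apply: contrapT => nog; apply: noK; exists K => // g gF.
    by rewrite leNgt; apply/negP => ?; apply: nog; exists g.
  set N := [fset k in K | _] => ltN.
  pose gN := [fset (g * k)%g | k in N].
  have cardgN : #|` gN| = #|` N| by apply: card_imfset; exact: mulgI.
  have disj : #|` K `|` gN| = (#|` K| + #|` N|)%N.
    rewrite -cardgN -cardfsUI (_ : K `&` gN = fset0) ?cardfs0 ?addn0 //.
    apply/fsetP => x; rewrite !inE; apply/negP => /andP[xK /imfsetP[k /=]].
    by rewrite !inE => /andP[_ /negP nK] xk; apply: nK; rewrite -xk.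
  have sub : K `|` gN `<=` fset_mul F1 K.
    apply/fsubsetP => x; rewrite inE => /orP[xK|/imfsetP[k /=]].
      by rewrite -[x]mul1g mem_fset_mul // !inE eqxx.
    by rewrite !inE => /andP[kK _] ->; rewrite mem_fset_mul // !inE gF orbT.
  have := fsubset_leq_card sub; rewrite disj -(ler_nat R) natrD; lra.
(* [P n] is the [n]-fold product set of [F1]; it expands every finite set by the factor
   [(1 + eps) ^ n]. *)
pose P n := iter n (fset_mul F1) [fset 1%g].
have growP n (K : {fset G}) :
    ((1 + eps) ^+ n * #|` K|%:R <= #|` fset_mul (P n) K|%:R :> R)%R.
  have itK : iter n (fset_mul F1) K `<=` fset_mul (P n) K.
    elim: n => [|n IH]; apply/fsubsetP => x.
      by move=> xK; rewrite -[x]mul1g mem_fset_mul // inE.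
    move=> /fset_mulP[a aF [_ /(fsubsetP IH)/fset_mulP[p pP [k kK ->]] ->]].
    by rewrite mulgA; apply: mem_fset_mul => //; apply: mem_fset_mul.
  apply: (@le_trans _ _ #|` iter n (fset_mul F1) K|%:R%R); last first.
    by rewrite ler_nat; exact: fsubset_leq_card.
  elim: n {itK} => [|n IH]; first by rewrite expr0 mul1r.
  rewrite exprS -mulrA; apply: le_trans (grow _).
  by apply: ler_wpM2l => //; lra.
have bernoulli n : (1 + n%:R * eps <= (1 + eps) ^+ n :> R)%R.
  elim: n => [|n IH]; first by rewrite mul0r addr0 expr0.
  rewrite exprS -natr1; apply: (@le_trans _ _ ((1 + eps) * (1 + n%:R * eps))%R).
    have : (0 <= n%:R * eps * eps :> R)%R by rewrite !mulr_ge0 // ltW.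
    nra.
  by apply: ler_wpM2l => //; lra.
(* Taking [n] above [1 / eps] makes the expansion factor at least 2, by Bernoulli's inequality. *)
pose n := Num.Def.archi_bound eps^-1.
have n_eps : (1 <= n%:R * eps)%R.
  rewrite -ler_pdivrMr // mul1r; apply/ltW/archi_boundP.
  by rewrite invr_ge0 ltW.
apply: (@amenable_not_doubling (P n) amenG) => K.
rewrite -(ler_nat R) natrM; apply: le_trans (growP n K).
by apply: ler_wpM2r => //; have := bernoulli n; lra.
Qed.

End Folner.

(** * Extension of partial injections to permutations *)

Section PartialInjections.
Variable T : finType.

Lemma extend_partial_injection (D : {set T}) (f : T -> T) :
  {in D &, injective f} -> exists p : {perm T}, {in D, p =1 f}.
Proof.
have [n] := ubnP #|D|; elim: n D => // n IH D ltDn inj_f.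
have [->|[x xD]] := set_0Vmem D; first by exists 1%g => x; rewrite inE.
have [|y z|p pE] := IH (D :\ x).
- by rewrite (cardsD1 x) xD in ltDn.
- by rewrite !inE => /andP[_ yD] /andP[_ zD]; exact: inj_f.
(* The transposition corrects the value at [x]; it fixes the other values on [D], which differ from
   [p x] and, by injectivity of [f], from [f x]. *)
exists (p * tperm (p x) (f x))%g => y yD; rewrite permM.
have [->|yx] := eqVneq y x; first by rewrite tpermL.
have yDx : y \in D :\ x by rewrite !inE yx.
rewrite -(pE y yDx) tpermD //; first by rewrite (inj_eq perm_inj) eq_sym.
by rewrite (pE y yDx); apply: contra_neq yx => /(inj_f _ _ xD yD).
Qed.

End PartialInjections.

(** * Permutations of a finite set that extend left translations *)

Section SoficModel.
Variables (G : groupType) (K : {fset G}).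
Local Open Scope fset_scope.

Lemma translation_perm : exists phi : G -> {perm K},
  forall g (k : K), (g * val k)%g \in K -> val (phi g k) = (g * val k)%g.
Proof.
have /choice[phi phiE] g : exists p : {perm K},
    forall k : K, (g * val k)%g \in K -> val (p k) = (g * val k)%g.
  (* The default [k] only makes [f] total: injectivity is asked only where the translate stays in
     [K]. *)
  pose f (k : K) : K := insubd k (g * val k)%g.
  have fE (k : K) : (g * val k)%g \in K -> val (f k) = (g * val k)%g.
    by move=> gk; rewrite /f val_insubd gk.
  have [k l|p pE] := @extend_partial_injection _ [set k : K | (g * val k)%g \in K]%SET f.
    rewrite !inE => gk gl /(congr1 val); rewrite !fE // => /mulgI.
    exact: val_inj.
  by exists p => k gk; rewrite pE ?inE // fE.
by exists phi.
Qed.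

Lemma card_fset_sub (P : pred G) : #|[pred k : K | P (val k)]| = #|` [fset k in K | P k]|.
Proof.
have -> : [fset k in K | P k] = [fset val k | k in [pred k : K | P (val k)]].
  apply/fsetP => x; rewrite !inE; apply/andP/imfsetP => [[xK Px]|[k /= Pk ->]].
    by exists [` xK].
  by split; [exact: valP|].
by rewrite card_imfset ?cardE //; exact: val_inj.
Qed.

End SoficModel.

(** * Soficity of the action, with a Folner set as model *)

Theorem theorem2p17 (R : realType) (G : groupType) (X : choiceType)
    (act : G -> X -> X)
    (hG : countable [set: G]) (hX : countable [set: X])
    (hamen : amenable R G) (hact : is_left_action act) :
  sofic_action R act.
Proof.
have [act1 actM] := hact; move=> F E eps eps0.
have act_inj g : injective (act g).
  by move=> x y /(congr1 (act g^-1%g)); rewrite -!actM mulVg !act1.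
(* Multiplicativity at [g], [h] also needs most points to stay in [K] under [g * h]. *)
pose F2 := (F `|` fset_mul F F)%fset.
(* The set [S] costs [#|F|] bad sets and multiplicativity costs two; the 3 leaves room for strict
   inequality in both. *)
pose eps' : R := (eps / (#|` F|%:R + 3))%R.
have card0 : (0 <= #|` F|%:R :> R)%R by [].
have eps'0 : (0 < eps')%R by rewrite divr_gt0 //; lra.
have epsE : (eps = #|` F|%:R * eps' + 3 * eps')%R.
  by rewrite /eps'; field; apply: lt0r_neq0; lra.
have [K K0 folK] := folner F2 hamen eps'0.
have cardK : (0 < #|` K|%:R :> R)%R by rewrite ltr0n cardfs_gt0.
have [phi phiE] := translation_perm K.
pose bad g : {set K} := [set k : K | (g * val k)%g \notin K]%SET.
have badF g : g \in F2 -> (#|bad g|%:R <= eps' * #|` K|%:R :> R)%R.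
  move=> /folK; rewrite -(card_fset_sub K (fun k => (g * k)%g \notin K)).
  by rewrite cardsE.
exists K, phi; split.
- by rewrite -cardfE cardfs_gt0.
- by apply/permP => k; apply/val_inj; rewrite perm1 phiE mul1g //; exact: valP.
- move=> g h gF hF; rewrite /hamming -cardfE ltr_pdivrMr //.
  (* If [h k] and [g h k] both stay in [K], all three permutations act there as true
     translations. *)
  have sub : [pred a | phi (g * h)%g a != (phi h * phi g)%g a] \subset bad h :|: bad (g * h)%g.
    apply/fintype.subsetP => k; rewrite !inE; apply: contraR.
    rewrite negb_or !negbK => /andP[hk ghk]; apply/eqP/val_inj.
    by rewrite permM (phiE (g * h)%g) // phiE phiE // mulgA.
  apply: (@le_lt_trans _ _ (#|bad h|%:R + #|bad (g * h)%g|%:R)%R).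
    rewrite -natrD ler_nat; apply: leq_trans (subset_leq_card sub) _.
    by rewrite cardsU leq_subr.
  have /badF badh : h \in F2 by rewrite inE hF.
  have /badF badgh : (g * h)%g \in F2 by rewrite inE mem_fset_mul ?orbT.
  have : (0 <= #|` F|%:R * eps' :> R)%R by rewrite mulr_ge0 // ltW.
  nra.
pose B : {fset X} := [fset act k^-1%g x | k in K, x in E]%fset.
have memB (s : K) (x : E) : act (val s)^-1%g (val x) \in B.
  by apply: in_imfset2; exact: valP.
(* On [S], every [g] in [F] acts by [phi g s = g s], so the orbit relation reduces to
   [(g s)^-1 x = s^-1 (g^-1 x)]. *)
pose S : {set K} := ~: (\bigcup_(g : F) bad (val g)).
have S_good s g : s \in S -> g \in F -> (g * val s)%g \in K.
  move=> sS gF; apply: contraLR sS => gs; rewrite inE negbK.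
  by apply/bigcupP; exists [` gF]%fset; rewrite // inE.
exists B, S, (fun s x => [` memB s x]%fset); split.
- have cardSC : (#|~: S|%:R <= #|` F|%:R * (eps' * #|` K|%:R) :> R)%R.
    rewrite /S finset.setCK.
    apply: (@le_trans _ _ (\sum_(g : F) #|bad (val g)|)%:R%R).
      rewrite ler_nat; elim/big_ind2: _ => //; first by rewrite cards0.
      move=> A1 n1 A2 n2 le1 le2; apply: leq_trans (leq_add le1 le2).
      by rewrite cardsU leq_subr.
    rewrite natr_sum; apply: (@le_trans _ _ (\sum_(g : F) (eps' * #|` K|%:R))%R).
      by apply: ler_sum => g _; apply: badF; rewrite inE (valP g).
    by rewrite sumr_const -cardfE mulr_natl.
  have : (#|S|%:R + #|~: S|%:R = #|` K|%:R :> R)%R.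
    by rewrite -natrD cardsC cardfE.
  rewrite -cardfE; have := mulr_gt0 eps'0 cardK; nra.
- move=> s _ x y /(congr1 val) /= /act_inj; exact: val_inj.
- move=> s g x y sS gF _ yE; apply: val_inj => /=.
  by rewrite phiE ?S_good // invMg actM yE.
Qed.
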